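(* Let $\mathtt P\in\mathcal A$. For every $k\ge1$, the line $\mathfrak L_k$ supporting $\mathrm{Orbit}^{(k)}(\mathtt P)$ is parallel to the diagonal line $\mathfrak L_D:=\mathrm{Aff}\{\mathtt{PR},\mathtt{SR}\}$. In particular, for all $k,\ell\ge1$, the supporting lines $\mathfrak L_k$ and $\mathfrak L_\ell$ of $\mathrm{Orbit}^{(k)}(\mathtt P)$ and $\mathrm{Orbit}^{(\ell)}(\mathtt P)$ are parallel to each other.
   Context: Boxes are elements of the real vector space $\mathcal B$ of functions $\{0,1\}^4\to\mathbb R$, written $\mathtt P(a,b\,|\,x,y)$. Define $\mathtt{PR}(a,b|x,y)=\frac12\mathbf 1_{a\oplus b=xy}$, $\mathtt{SR}(a,b|x,y)=\frac12\mathbf 1_{a=b}$, $\mathtt I(a,b|x,y)=\frac14$, where $\oplus$ is addition mod 2. These three boxes are affinely independent; let $\mathcal A=\mathrm{Aff}\{\mathtt{PR},\mathtt{SR},\mathtt I\}$ be their affine hull. Every $\mathtt A\in\mathcal A$ is uniquely written $\mathtt A=c_1(\mathtt A)\mathtt{PR}+c_2(\mathtt A)\mathtt{SR}+c_3(\mathtt A)\mathtt I$ with $c_1(\mathtt A)+c_2(\mathtt A)+c_3(\mathtt A)=1$. The product $\boxtimes$ (induced by the wiring $\mathsf W_{\mathrm{BS}}$) is the bilinear operation on $\mathcal B$ $$\mathtt P\boxtimes\mathtt Q(a,b|x,y)=\sum_{a_1,a_2,b_1,b_2\in\{0,1\}}\mathtt P(a_1,b_1|x,y)\,\mathtt Q(a_2,b_2|xa_1,yb_1)\,\mathbf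 1_{a=a_1\oplus a_2}\mathbf 1_{b=b_1\oplus b_2};$$ $\mathcal A$ is stable under it. $\mathrm{Orbit}^{(k)}(\mathtt P)$ is the set of all products of $k$ copies of $\mathtt P$ over all parenthesizations: $\mathrm{Orbit}^{(1)}(\mathtt P)=\{\mathtt P\}$ and, for $k\ge2$, $\mathrm{Orbit}^{(k)}(\mathtt P)=\bigcup_{1\le\ell\le k-1}\{\mathtt Q_1\boxtimes\mathtt Q_2:\mathtt Q_1\in\mathrm{Orbit}^{(\ell)}(\mathtt P),\mathtt Q_2\in\mathrm{Orbit}^{(k-\ell)}(\mathtt P)\}$. The supporting line of $\mathrm{Orbit}^{(k)}(\mathtt P)$ is the line $\mathfrak L_k:=\{\mathtt A\in\mathcal A:c_3(\mathtt A)=1-(1-c_3(\mathtt P))^k\}$, which contains $\mathrm{Orbit}^{(k)}(\mathtt P)$. Two lines are parallel if they have the same direction (coinciding lines are allowed). *)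

(* Defs.v *)
From HB Require Import structures.
From mathcomp Require Import all_boot all_order all_algebra.
From mathcomp Require Import boolp classical_sets reals.
From mathcomp Require Import ring lra.

Set Implicit Arguments.
Unset Strict Implicit.
Unset Printing Implicit Defensive.
Import Order.TTheory GRing.Theory Num.Theory.
Local Open Scope classical_set_scope.
Local Open Scope ring_scope.

(* [P (a, b, x, y)] is P(a, b | x, y); the bits 0 and 1 are [false] and [true],
   so that [(+)] is addition mod 2 and [&&] is multiplication.  [R^o] is [R]
   seen as a module over itself; it makes [box R] a vector space over [R]. *)
Definition box (R : realType) := {ffun bool * bool * bool * bool -> R^o}.

Definition PR (R : realType) : box R :=
  [ffun i => let: (a, b, x, y) := i in 2^-1 * ((a (+) b) == (x && y))%:R].

Definition SR (R : realType) : box R :=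
  [ffun i => let: (a, b, x, y) := i in 2^-1 * (a == b)%:R].

Definition Ibox (R : realType) : box R := [ffun=> 4^-1].

Arguments PR {R}.
Arguments SR {R}.
Arguments Ibox {R}.

Definition Aff (R : realType) (V : lmodType R) (S : set V) : set V :=
  [set v | exists (n : nat) (c : 'I_n -> R) (p : 'I_n -> V),
    [/\ forall i, S (p i), \sum_i c i = 1 & v = \sum_i c i *: p i]].

Definition calA (R : realType) : set (box R) := Aff [set PR; SR; Ibox].
Arguments calA {R}.

Definition is_coords (R : realType) (A : box R) (c : R * R * R) : Prop :=
  A = c.1.1 *: PR + c.1.2 *: SR + c.2 *: Ibox /\ c.1.1 + c.1.2 + c.2 = 1.

Lemma is_coords_unique (R : realType) (A : box R) (c c' : R * R * R) :
  is_coords A c -> is_coords A c' -> c = c'.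
Proof.
case: c c' => [[c1 c2] c3] [[d1 d2] d3] [/= -> h] [/= /ffunP e h'].
have := e (false, true, false, false); have := e (false, false, true, true).
rewrite !ffunE /= /GRing.scale /= => h1 h2.
by congr (_, _, _); lra.
Qed.

Lemma is_coords_ex (R : realType) (A : box R) :
  calA A -> exists c, is_coords A c.
Proof.
case=> n [c] [p] [pS c1 ->].
pose ind (B : box R) i : R := (`[< p i = B >])%:R.
pose d1 i := ind PR i.
pose d2 i := (1 - d1 i) * ind SR i.
pose d3 i := 1 - d1 i - d2 i.
have pE i : p i = d1 i *: PR + d2 i *: SR + d3 i *: Ibox.
  rewrite /d3 /d2 /d1 /ind.
  case: asboolP => [->|n1]; first by rewrite subrr mul0r subr0 scale1r !scale0r !addr0.
  case: asboolP => [->|n2]; first by rewrite subr0 mulr1 subrr scale1r !scale0r add0r addr0.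
  rewrite mulr0 !subr0 scale1r !scale0r !add0r.
  by case: (pS i) => // -[].
exists (\sum_i c i * d1 i, \sum_i c i * d2 i, \sum_i c i * d3 i).
split=> /=.
  rewrite !scaler_suml -!big_split /=; apply: eq_bigr => i _.
  by rewrite [in LHS]pE !scalerDr !scalerA.
rewrite -c1 -!big_split /=; apply: eq_bigr => i _.
by rewrite /d3; ring.
Qed.

(* The triple (c1(A), c2(A), c3(A)), with junk value 0 when A is not in the
   affine hull. *)
Definition coords (R : realType) (A : box R) : R * R * R :=
  xget (0, 0, 0) [set c | is_coords A c].

Definition c3 (R : realType) (A : box R) : R := (coords A).2.

Lemma coordsP (R : realType) (A : box R) :
  calA A -> is_coords A (coords A).
Proof. by move=> /is_coords_ex[c Ac]; exact: (xgetI (0, 0, 0) Ac). Qed.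

Definition boxprod (R : realType) (P Q : box R) : box R :=
  [ffun i => let: (a, b, x, y) := i in
    \sum_(a1 : bool) \sum_(a2 : bool) \sum_(b1 : bool) \sum_(b2 : bool)
      P (a1, b1, x, y) * Q (a2, b2, x && a1, y && b1)
        * (a == a1 (+) a2)%:R * (b == b1 (+) b2)%:R].

Inductive Orbit (R : realType) (P : box R) : nat -> set (box R) :=
| Orbit_one : Orbit P 1 P
| Orbit_prod (k l : nat) (Q1 Q2 : box R) :
    (1 <= l <= k - 1)%N -> Orbit P l Q1 -> Orbit P (k - l)%N Q2 ->
    Orbit P k (boxprod Q1 Q2).

Definition suppline (R : realType) (P : box R) (k : nat) : set (box R) :=
  [set A | calA A /\ c3 A = 1 - (1 - c3 P) ^+ k].

Definition diagline (R : realType) : set (box R) := Aff [set PR; SR].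
Arguments diagline {R}.

Definition is_line (R : realType) (V : lmodType R) (L : set V) : Prop :=
  exists p d : V, d != 0 /\ L = [set p + t *: d | t in [set: R]].

(* The direction of a nonempty affine subspace, as a linear subspace. *)
Definition direction (R : realType) (V : lmodType R) (L : set V) : set V :=
  [set u - v | u in L & v in L].

Definition parallel (R : realType) (V : lmodType R) (L M : set V) : Prop :=
  [/\ is_line L, is_line M & direction L = direction M].

(* Main.v *)
(* Writing w(A) = 1 - c3(A) = c1(A) + c2(A), the multiplication table of PR, SR
   and I shows that w is multiplicative on the affine hull, so w = w(P)^k on
   Orbit^(k)(P).  A level set of w is a translate of the line through 0 and
   PR - SR, which is also the direction of the diagonal line. *)
Require Import Defs.
From mathcomp Require Import all_boot all_order all_algebra.
From mathcomp Require Import boolp classical_sets reals.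
From mathcomp Require Import ring lra zify.
Set Implicit Arguments.
Unset Strict Implicit.
Unset Printing Implicit Defensive.
Import Order.TTheory GRing.Theory Num.Theory.
Local Open Scope classical_set_scope.
Local Open Scope ring_scope.

Section AffineLines.
Context (R : realType) (V : lmodType R).
Implicit Types p q d v : V.

Lemma direction_line p d :
  direction [set p + t *: d | t in [set: R]] = [set t *: d | t in [set: R]].
Proof.
apply/seteqP; split=> v /=.
  case=> _ [s _ <-] [_ [t _ <-] <-]; exists (s - t) => //.
  by rewrite scalerBl opprD addrACA subrr add0r.
case=> t _ <-; exists (p + t *: d); first by exists t.
exists p; first by exists 0 => //; rewrite scale0r addr0.
by rewrite addrC addKr.
Qed.

Lemma parallel_lines p q d : d != 0 ->
  parallel [set p + t *: d | t in [set: R]] [set q + t *: d | t in [set: R]].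
Proof.
by move=> d0; split; [exists p, d|exists q, d|rewrite !direction_line].
Qed.

(** This puts the diagonal, given as an affine hull, in the point-plus-direction form used for the
    level sets of [c3]. *)
Lemma Aff_pair p q :
  Aff [set p; q] = [set q + t *: (p - q) | t in [set: R]].
Proof.
apply/seteqP; split=> v /=.
  case=> n [c] [f] [fS c1 ->].
  (* The parameter is the total weight carried by the indices whose point is [p]. *)
  exists (\sum_i c i * (`[< f i = p >])%:R) => //.
  rewrite -[X in X + _]scale1r -[X in X *: q]c1 !scaler_suml -big_split /=.
  apply: eq_bigr => i _; case: asboolP => [->|fNp] /=.
    by rewrite mulr1 -scalerDr addrC subrK.
  by case: (fS i) => // ->; rewrite mulr0 scale0r addr0.
case=> t _ <-; exists 2.
exists (fun i : 'I_2 => if i == ord0 then t else 1 - t).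
exists (fun i : 'I_2 => if i == ord0 then p else q).
split; first by move=> i; case: ifP => _; [left|right].
  by rewrite !big_ord_recl big_ord0 /= addr0 addrC subrK.
rewrite !big_ord_recl big_ord0 /= addr0 scalerBl scale1r scalerBr.
by rewrite addrCA.
Qed.

End AffineLines.

Section Boxes.
Context (R : realType).
Implicit Types (P Q A : box R) (c : R * R * R).

Lemma PR_neq_SR : PR - SR != 0 :> box R.
Proof.
(* At this entry [PR] vanishes while [SR] is 1/2. *)
apply/eqP => /ffunP /(_ (false, false, true, true)).
rewrite !ffunE /= => h; have : (2^-1 : R) = 0 by lra.
by move/eqP; rewrite invr_eq0 pnatr_eq0.
Qed.

Lemma is_coords_calA A c : is_coords A c -> calA A.
Proof.
case: c => [[x y] z] [/= -> s1]; exists 3.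
exists (fun i : 'I_3 => nth 0 [:: x; y; z] i).
exists (fun i : 'I_3 => nth 0 [:: PR; SR; Ibox] i).
split; last 2 first.
- by rewrite !big_ord_recl big_ord0 /= addr0 addrA.
- by rewrite !big_ord_recl big_ord0 /= addr0 addrA.
by case=> -[|[|[|//]]] _ /=; [left; left|left; right|right].
Qed.

(** Since [c3] rests on a choice of coordinates, uniqueness is what lets it be read off any explicit
    decomposition. *)
Lemma is_coords_c3 A c : is_coords A c -> c3 A = c.2.
Proof.
move=> Ac; have Ac' := coordsP (is_coords_calA Ac).
by rewrite /c3 (is_coords_unique Ac' Ac).
Qed.

(* PR PR = PR SR = PR, SR PR = (PR + SR)/2, SR SR = SR,
   I PR = (PR - SR)/4 + I, and the other four products are I. *)
Lemma is_coords_boxprod P Q p1 p2 p3 q1 q2 q3 :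
  is_coords P (p1, p2, p3) -> is_coords Q (q1, q2, q3) ->
  is_coords (boxprod P Q)
    (p1 * (q1 + q2) + p2 * q1 / 2 + p3 * q1 / 4,
     p2 * q1 / 2 + p2 * q2 - p3 * q1 / 4,
     1 - (1 - p3) * (1 - q3)).
Proof.
case=> /= -> hp [/= -> hq]; have -> : p3 = 1 - p1 - p2 by lra.
have -> : q3 = 1 - q1 - q2 by lra.
split=> /=; last by field.
apply/ffunP => -[[[a b] x] y]; rewrite !ffunE !big_bool /= !ffunE.
rewrite /GRing.scale /=.
by case: a; case: b; case: x; case: y => /=; field.
Qed.

Lemma boxprod_calA P Q : calA P -> calA Q -> calA (boxprod P Q).
Proof.
move=> /coordsP + /coordsP.
case: (coords P) (coords Q) => [[? ?] ?] [[? ?] ?] hP hQ.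
exact: is_coords_calA (is_coords_boxprod hP hQ).
Qed.

(** A product of two basis boxes has [Ibox] weight 1 if a factor is [Ibox], and 0 otherwise;
    bilinearity does the rest. *)
Lemma c3_boxprod P Q : calA P -> calA Q ->
  1 - c3 (boxprod P Q) = (1 - c3 P) * (1 - c3 Q).
Proof.
move=> /coordsP + /coordsP; rewrite /(c3 P) /(c3 Q).
case: (coords P) (coords Q) => [[? ?] ?] [[? ?] ?] hP hQ.
by rewrite (is_coords_c3 (is_coords_boxprod hP hQ)) /= subKr.
Qed.

Lemma Orbit_suppline P k : calA P -> Orbit P k `<=` suppline P k.
Proof.
move=> hP A; elim=> [|{}k l Q1 Q2 lk _ [Q1A e1] _ [Q2A e2]].
  by split=> //; rewrite expr1 subKr.
split; first exact: boxprod_calA.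
(* The exponents [l] and [k - l] add up to [k], as [l <= k - 1] rules out truncation. *)
have := c3_boxprod Q1A Q2A; rewrite e1 e2 !subKr -exprD subnKC; last by lia.
by move=> <-; rewrite subKr.
Qed.

Lemma c3_level_line (s : R) :
  [set A : box R | calA A /\ c3 A = s] =
  [set ((1 - s) *: SR + s *: Ibox) + t *: (PR - SR) | t in [set: R]].
Proof.
apply/seteqP; split=> A /=.
  case=> /coordsP; rewrite /c3; case: (coords A) => [[x y] z] [/= -> h] <-.
  (* The line parameter is the [PR] coordinate; the base point is the box of the level set where it
     is 0. *)
  exists x => //; have -> : y = 1 - z - x by lra.
  by apply/ffunP => i; rewrite !ffunE /GRing.scale /=; ring.
case=> t _ <-.
have Ac : is_coords ((1 - s) *: SR + s *: Ibox + t *: (PR - SR))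
    (t, 1 - s - t, s).
  split=> /=; last by ring.
  by apply/ffunP => i; rewrite !ffunE /GRing.scale /=; ring.
by split; [exact: is_coords_calA Ac|rewrite (is_coords_c3 Ac)].
Qed.

End Boxes.

Theorem corollary11 (R : realType) (P : box R) (hP : calA P) :
  (forall k : nat, (1 <= k)%N ->
     Orbit P k `<=` suppline P k /\ parallel (suppline P k) diagline) /\
  (forall k l : nat, (1 <= k)%N -> (1 <= l)%N ->
     parallel (suppline P k) (suppline P l)).
Proof.
have d0 := @PR_neq_SR R.
split=> [k _|k l _ _]; last by rewrite /suppline !c3_level_line; exact: parallel_lines.
split; first exact: Orbit_suppline.
(* Both lines now carry the same direction vector [PR - SR]. *)
by rewrite /suppline c3_level_line /diagline Aff_pair; exact: parallel_lines.
Qed.
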